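(* Let $\mathfrak g$ be a $2$-step solvable Lie algebra endowed with a complex structure $J$. Then $\eta=0$ if and only if $\mathfrak g$ is $J$-solvable. In particular, in this case, $\dfrac{\mathfrak g'+J\mathfrak g'}{\mathfrak g'_J}$ is nilpotent.
   Context: All Lie algebras are finite-dimensional and real. A complex structure on $\mathfrak g$ is $J\in\mathrm{End}(\mathfrak g)$ with $J^2=-\mathrm{Id}$ and $[X,Y]+J[JX,Y]+J[X,JY]-[JX,JY]=0$ for all $X,Y$. Write $\mathfrak g'=[\mathfrak g,\mathfrak g]$, $\mathfrak g'_J=\mathfrak g'\cap J\mathfrak g'$. $2$-step solvable means $[\mathfrak g',\mathfrak g']=0$; in this case $\mathfrak g'_J$ is a $J$-invariant ideal of $\mathfrak g'+J\mathfrak g'$. The $2$-form $\eta$ on $\mathfrak g$ is $\eta(X,Y)=-\frac12\mathrm{tr}(J\,\mathrm{ad}_{[X,Y]})$. $\mathfrak g$ is $J$-solvable if the series $\mathfrak g^{[0]}(J)=\mathfrak g$, $\mathfrak g^{[j+1]}(J)=[\mathfrak g^{[j]}(J),\mathfrak g^{[j]}(J)]+J[\mathfrak g^{[j]}(J),\mathfrak g^{[j]}(J)]$ reaches $0$. *)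

(* Defs.v *)
From HB Require Import structures.
From mathcomp Require Import all_boot all_order all_algebra.
From mathcomp Require Import reals.

Set Implicit Arguments.
Unset Strict Implicit.
Unset Printing Implicit Defensive.

Import GRing.Theory.
Import passmx.

Local Open Scope ring_scope.
Local Open Scope quotient_scope.

(* [mxof] acts on row vectors, so this is the trace of the transpose of the
   usual matrix; [lfun_traceE] shows that the basis is irrelevant. *)
Definition lfun_trace (F : fieldType) (V : vectType F) (f : 'End(V)) : F :=
  \tr (mxof (vbasis {:V}) (vbasis {:V}) f).

Lemma lfun_traceE (F : fieldType) (V : vectType F) (e : (\dim {:V}).-tuple V)
    (f : 'End(V)) : basis_of {:V} e -> lfun_trace f = \tr (mxof e e f).
Proof.
move=> be; set b := vbasis {:V}.
have bb : basis_of {:V} b by exact: vbasisP.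
rewrite /lfun_trace -/b.
have -> : mxof e e f = mxof e b \1%VF *m (mxof b b f *m mxof b e \1%VF).
  by rewrite -!mxof_comp ?comp_lfun1l ?comp_lfun1r.
rewrite mxtrace_mulC -mulmxA -mxof_comp // comp_lfun1l.
suff -> : mxof b b (\1 : 'End(V))%VF = 1%:M by rewrite mulmx1.
by rewrite mxof1 // (basis_free bb).
Qed.

Section QuotientSpace.
Variables (F : fieldType) (V : vectType F) (U : {vspace V}).

Definition quotv : Type := Quotient.quot (pred_of_vspace U).
HB.instance Definition _ := GRing.Zmodule.on quotv.

Definition piv (v : V) : quotv := \pi_(Quotient.quot (pred_of_vspace U)) v.
Definition reprv (a : quotv) : V := repr (a : Quotient.quot (pred_of_vspace U)).

Lemma reprvK : cancel reprv piv.
Proof. by move=> a; rewrite /piv /reprv reprK. Qed.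

Lemma pivP (x y : V) : (piv x = piv y) <-> (x - y \in U).
Proof.
have := @Quotient.idealrBE V (pred_of_vspace U) x y.
rewrite /piv => ->.
by split=> [->|/eqP].
Qed.

Lemma reprv_piv (x : V) : reprv (piv x) - x \in U.
Proof. by apply/pivP; rewrite reprvK. Qed.

Lemma pivD (x y : V) : piv (x + y) = piv x + piv y.
Proof. by rewrite /piv raddfD. Qed.

Definition scaleqv (k : F) (a : quotv) : quotv := piv (k *: reprv a).

Lemma pivZ_sub (k : F) (x : V) : piv (k *: x) = scaleqv k (piv x).
Proof.
by apply/pivP; rewrite -scalerBr memvZ // -opprB memvN reprv_piv.
Qed.

Fact scaleqvA (a b : F) (x : quotv) :
  scaleqv a (scaleqv b x) = scaleqv (a * b) x.
Proof. by rewrite -[x]reprvK -!pivZ_sub scalerA. Qed.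
Fact scaleqv1 : left_id 1 scaleqv.
Proof. by move=> x; rewrite -[x]reprvK -pivZ_sub scale1r. Qed.
Fact scaleqvDr : right_distributive scaleqv +%R.
Proof.
by move=> a x y; rewrite -[x]reprvK -[y]reprvK -pivD -!pivZ_sub -pivD scalerDr.
Qed.
Fact scaleqvDl (v : quotv) : {morph scaleqv^~ v : a b / a + b}.
Proof. by move=> a b; rewrite -[v]reprvK -!pivZ_sub -pivD scalerDl. Qed.

HB.instance Definition _ := GRing.Zmodule_isLmodule.Build F quotv
  scaleqvA scaleqv1 scaleqvDr scaleqvDl.

Fact piv_linear : linear piv.
Proof. by move=> k x y; rewrite pivD pivZ_sub. Qed.
HB.instance Definition _ :=
  GRing.isSemilinear.Build F V quotv _ piv (GRing.semilinear_linear piv_linear).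

Lemma piv_eq0 (x : V) : (piv x == 0) = (x \in U).
Proof.
rewrite -(linear0 piv); apply/eqP/idP => [/pivP|xU]; first by rewrite subr0.
by apply/pivP; rewrite subr0.
Qed.


Fact quotv_vect_iso : Vector.axiom (\dim (U^C)) quotv.
Proof.
pose W := (U^C)%VS; pose p := daddv_pi W U.
have WU0 : (W :&: U = 0)%VS by rewrite capvC capv_compl.
have UW0 : (U :&: W = 0)%VS by exact: capv_compl.
have pD x : p x + daddv_pi U W x = x.
  by rewrite daddv_pi_add // addvC addv_complf memvf.
have pU u : u \in U -> p u = 0.
  by move=> uU; have := pD u; rewrite daddv_pi_id // => /(canRL (addrK _)) ->;
     rewrite subrr.
have pr x : p (reprv (piv x)) = p x.
  by have /eqP := pU _ (reprv_piv x); rewrite linearB subr_eq0 => /eqP.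
exists (fun a => \row_i coord (vbasis W) i (p (reprv a))).
  move=> k a b; apply/rowP=> i; rewrite !mxE.
  rewrite -[a]reprvK -[b]reprvK -linearP !pr.
  by rewrite !linearP.
exists (fun rw : 'rV_(\dim W) => piv (\sum_i rw 0 i *: (vbasis W)`_i)).
  move=> a /=; rewrite -[RHS]reprvK; apply/pivP.
  rewrite (eq_bigr (fun i => coord (vbasis W) i (p (reprv a)) *: (vbasis W)`_i));
    last by move=> i _; rewrite mxE.
  rewrite -(coord_vbasis (memv_pi _ _ _)) -{2}[reprv a]pD opprD addrA subrr.
  by rewrite add0r memvN memv_pi.
move=> rw; apply/rowP=> i; rewrite mxE pr daddv_pi_id //.
  by rewrite coord_sum_free ?(basis_free (vbasisP _)).
by apply: rpred_sum => j _; rewrite rpredZ ?vbasis_mem ?memt_nth.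
Qed.
HB.instance Definition _ := Lmodule_hasFinDim.Build F quotv quotv_vect_iso.

End QuotientSpace.

Arguments piv {F V} U v.
Arguments reprv {F V U} a.

Record lieStructure (F : fieldType) (V : vectType F) := LieStructure {
  bracket :> V -> V -> V;
  bracket_linearl : forall y, linear (bracket^~ y);
  bracket_linearr : forall x, linear (bracket x);
  bracket_alt : forall x, bracket x x = 0;
  bracket_jacobi : forall x y z,
    bracket x (bracket y z) + bracket y (bracket z x)
      + bracket z (bracket x y) = 0
}.

Section Lie.
Variables (F : fieldType) (V : vectType F) (L : lieStructure V).

HB.instance Definition _ x := GRing.isSemilinear.Build F V V _ (bracket L x)
  (GRing.semilinear_linear (bracket_linearr L x)).

Definition ad (x : V) : 'End(V) := linfun (bracket L x).

Lemma adE (x y : V) : ad x y = L x y.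
Proof. by rewrite lfunE. Qed.

Lemma bracketDl x y z : L (x + y) z = L x z + L y z.
Proof. by have := bracket_linearl L z 1 x y; rewrite !scale1r. Qed.

Lemma bracket0l z : L 0 z = 0.
Proof. by have /eqP := bracketDl 0 0 z; rewrite addr0 -subr_eq subrr => /eqP. Qed.

Lemma bracketZl k x z : L (k *: x) z = k *: L x z.
Proof.
by have := bracket_linearl L z k x 0; rewrite addr0 bracket0l addr0.
Qed.

Lemma bracketDr x y z : L x (y + z) = L x y + L x z.
Proof. exact: linearD. Qed.

Lemma bracketC x y : L x y = - L y x.
Proof.
have := bracket_alt L (x + y); rewrite bracketDl !bracketDr !bracket_alt.
by rewrite add0r addr0 => /eqP; rewrite addr_eq0 => /eqP.
Qed.

Definition lie_prod (A B : {vspace V}) : {vspace V} :=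
  <<[seq L a b | a <- vbasis A, b <- vbasis B]>>%VS.

Lemma mem_lie_prod (A B : {vspace V}) a b :
  a \in A -> b \in B -> L a b \in lie_prod A B.
Proof.
move=> aA bB; rewrite (coord_vbasis bB) linear_sum.
apply: memv_suml => j _; rewrite linearZ memvZ //= bracketC memvN.
rewrite (coord_vbasis aA) linear_sum; apply: memv_suml => i _.
rewrite linearZ memvZ //= bracketC memvN memv_span //.
by apply/allpairsP; exists ((vbasis A)`_i, (vbasis B)`_j); split=> //=;
  rewrite mem_nth // size_tuple.
Qed.

Lemma lie_prod_subP (A B W : {vspace V}) :
  reflect (forall a b, a \in A -> b \in B -> L a b \in W)
          (lie_prod A B <= W)%VS.
Proof.
apply: (iffP idP) => [/subvP sW a b aA bB|sW].
  exact/sW/mem_lie_prod.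
apply/span_subvP => _ /allpairsP[[a b] [/= /vbasis_mem aA /vbasis_mem bB ->]].
exact: sW.
Qed.

Definition derived : {vspace V} := lie_prod fullv fullv.

Fixpoint lower_central (n : nat) : {vspace V} :=
  if n is m.+1 then lie_prod fullv (lower_central m) else fullv.

Definition nilpotent : Prop := exists n, lower_central n = 0%VS.

Definition two_step_solvable : Prop := lie_prod derived derived = 0%VS.

Definition is_subalgebra (H : {vspace V}) : Prop :=
  forall u v, u \in H -> v \in H -> L u v \in H.

Definition is_ideal (I : {vspace V}) : Prop :=
  forall u v, v \in I -> L u v \in I.

Section Subalgebra.
Variables (H : {vspace V}) (hH : is_subalgebra H).

Definition sub_bracket (u v : subvs_of H) : subvs_of H :=
  Subvs (hH (subvsP u) (subvsP v)).

Fact sub_bracket_linearl y : linear (sub_bracket^~ y).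
Proof. by move=> k u v; apply: val_inj; exact: bracket_linearl. Qed.
Fact sub_bracket_linearr x : linear (sub_bracket x).
Proof. by move=> k u v; apply: val_inj; exact: bracket_linearr. Qed.
Fact sub_bracket_alt x : sub_bracket x x = 0.
Proof. by apply: val_inj; exact: bracket_alt. Qed.
Fact sub_bracket_jacobi x y z :
  sub_bracket x (sub_bracket y z) + sub_bracket y (sub_bracket z x)
    + sub_bracket z (sub_bracket x y) = 0.
Proof. by apply: val_inj; exact: bracket_jacobi. Qed.

Definition sub_lie : lieStructure (subvs_of H) :=
  LieStructure sub_bracket_linearl sub_bracket_linearr sub_bracket_alt
    sub_bracket_jacobi.

End Subalgebra.

Section Quotient.
Variables (I : {vspace V}) (hI : is_ideal I).

Definition quot_bracket (a b : quotv I) : quotv I := piv I (L (reprv a) (reprv b)).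

Lemma piv_bracket x y : piv I (L x y) = quot_bracket (piv I x) (piv I y).
Proof.
apply/pivP.
have -> : L x y - L (reprv (piv I x)) (reprv (piv I y)) =
    L y (reprv (piv I x) - x) - L (reprv (piv I x)) (reprv (piv I y) - y).
  rewrite !linearB /= [L y x]bracketC [L y (reprv _)]bracketC !opprK.
  by rewrite [RHS]addrC addrA addrK addrC.
by rewrite rpredB // hI // reprv_piv.
Qed.

Fact quot_bracket_linearl y : linear (quot_bracket^~ y).
Proof.
move=> k u v; rewrite -[u]reprvK -[v]reprvK -[y]reprvK -linearP.
by rewrite -!piv_bracket bracket_linearl linearP.
Qed.
Fact quot_bracket_linearr x : linear (quot_bracket x).
Proof.
move=> k u v; rewrite -[u]reprvK -[v]reprvK -[x]reprvK -linearP.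
by rewrite -!piv_bracket bracket_linearr linearP.
Qed.
Fact quot_bracket_alt x : quot_bracket x x = 0.
Proof. by rewrite -[x]reprvK -piv_bracket bracket_alt linear0. Qed.
Fact quot_bracket_jacobi x y z :
  quot_bracket x (quot_bracket y z) + quot_bracket y (quot_bracket z x)
    + quot_bracket z (quot_bracket x y) = 0.
Proof.
rewrite -[x]reprvK -[y]reprvK -[z]reprvK -!piv_bracket -!linearD.
by rewrite bracket_jacobi linear0.
Qed.

Definition quot_lie : lieStructure (quotv I) :=
  LieStructure quot_bracket_linearl quot_bracket_linearr quot_bracket_alt
    quot_bracket_jacobi.

End Quotient.

End Lie.

(* The subspace I :&: H of V, seen inside the vector space [subvs_of H]. *)
Definition restrv (F : fieldType) (V : vectType F) (H I : {vspace V}) :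
    {vspace subvs_of H} :=
  (linfun (@vsval _ _ H) @^-1: I)%VS.

Lemma mem_restrv (F : fieldType) (V : vectType F) (H I : {vspace V})
    (u : subvs_of H) : (u \in restrv H I) = (vsval u \in I).
Proof. by rewrite -memv_preim lfunE. Qed.

Section ComplexStructure.
Variables (F : fieldType) (V : vectType F) (L : lieStructure V) (J : 'End(V)).

Definition complex_structure : Prop :=
  (J \o J)%VF = - \1%VF /\
  forall x y, L x y + J (L (J x) y) + J (L x (J y)) - L (J x) (J y) = 0.

Definition eta (x y : V) : F :=
  - (2%:R)^-1 * lfun_trace (J \o ad L (L x y))%VF.

Fixpoint J_series (n : nat) : {vspace V} :=
  if n is m.+1 then
    (lie_prod L (J_series m) (J_series m)
       + J @: lie_prod L (J_series m) (J_series m))%VS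
  else fullv.

Definition J_solvable : Prop := exists n, J_series n = 0%VS.

Definition derived_plus : {vspace V} := (derived L + J @: derived L)%VS.
Definition derived_core : {vspace V} := (derived L :&: J @: derived L)%VS.

Section Ideal.
Hypotheses (hJ : complex_structure) (h2 : two_step_solvable L).

Let JK x : J (J x) = - x.
Proof. by have /lfunP/(_ x) := hJ.1; rewrite !lfun_simp. Qed.

Let nij x y : L x y + J (L (J x) y) + J (L x (J y)) = L (J x) (J y).
Proof. by apply/eqP; rewrite -subr_eq0 hJ.2. Qed.

Let mem_der x y : L x y \in derived L.
Proof. by rewrite mem_lie_prod ?memvf. Qed.

Let der0 x y : x \in derived L -> y \in derived L -> L x y = 0.
Proof. by move=> hx hy; apply/eqP; rewrite -memv0 -h2 mem_lie_prod. Qed.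

Lemma derived_plus_subalgebra : is_subalgebra L derived_plus.
Proof.
by move=> u v _ _; apply: (subvP (addvSl _ _)).
Qed.

Lemma derived_core_ideal :
  is_ideal (sub_lie derived_plus_subalgebra) (restrv derived_plus derived_core).
Proof.
move=> u v; rewrite !mem_restrv /= => /memv_capP[vD /memv_imgP[w wD vJw]].
have JvD : J (vsval v) \in derived L by rewrite vJw JK memvN.
case/memv_addP: (subvsP u) => a aD [_ /memv_imgP[b bD ->] ->].
rewrite bracketDl der0 // add0r memv_cap mem_der /=.
apply/memv_imgP; exists (L (J (vsval v)) (J b)); first exact: mem_der.
by rewrite -nij (der0 vD bD) (der0 JvD bD) linear0 !add0r JK bracketC.
Qed.

Definition derived_quotient : lieStructure (quotv (restrv derived_plus derived_core)) :=
  quot_lie derived_core_ideal.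

End Ideal.

End ComplexStructure.

(* Main.v *)
From HB Require Import structures.
Require Import Defs.
From mathcomp Require Import all_boot all_order all_algebra.
From mathcomp Require Import reals.

Set Implicit Arguments.
Unset Strict Implicit.
Unset Printing Implicit Defensive.

Import GRing.Theory Num.Theory.
Import passmx.

Local Open Scope ring_scope.

(* Write A = g', C = g'_J and x * y = [J x, y] on A. The Jacobi and Nijenhuis
   identities together with [A, A] = 0 give x * (y * z) = y * (x * z),
   (x * y) * z = (y * x) * z and [J x, J y] = J (x * y - y * x), whence
   x * y - y * x \in C, A * C <= C and C * A = 0. So A / C is a commutative
   associative algebra, and tr (J ad_z) is minus the trace of right multiplication
   by z. All these traces vanish iff every right multiplication is nilpotent, iff
   A / C is a nilpotent algebra; and A * ... * A <= C is what both J-solvability of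
   g and nilpotency of (g' + J g') / C amount to. *)

(** * Nilpotency of matrices and traces of their powers, in characteristic zero *)

Section MatrixNilpotency.
Variable F : numFieldType.

(** Swapping the two factors of [A = col_base A *m row_base A] keeps the traces of positive powers
    while lowering the size to the rank. *)
Definition mx_core n (A : 'M[F]_n) : 'M[F]_(\rank A) := row_base A *m col_base A.

Lemma mx_core_exp n (A : 'M[F]_n) k :
  A ^+ k.+1 = col_base A *m mx_core A ^+ k *m row_base A.
Proof.
elim: k => [|k IH]; first by rewrite expr1 expr0 mulmx1 mulmx_base.
by rewrite exprSr IH -[in X in _ * X](mulmx_base A) exprSr /GRing.mul /= !mulmxA.
Qed.

Lemma mxtrace_core_exp n (A : 'M[F]_n) k :
  \tr (mx_core A ^+ k.+1) = \tr (A ^+ k.+1).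
Proof.
by rewrite (mx_core_exp A) -mulmxA mxtrace_mulC -mulmxA exprSr.
Qed.

(** Cancelling the full-rank factors in [mx_core_exp] shows that the core needs one power less to
    vanish. *)
Lemma mxtrace_nilpotent n (A : 'M[F]_n) k : A ^+ k = 0 -> \tr A = 0.
Proof.
elim: k n A => [|k IH] n A Ak0.
  by rewrite -[A]mulmx1 (_ : 1%:M = A ^+ 0) // Ak0 mulmx0 mxtrace0.
rewrite -[A]expr1 -mxtrace_core_exp expr1; apply: IH.
apply: (row_full_inj (col_base_full A)); apply: (row_free_inj (row_base_free A)).
by rewrite -mx_core_exp Ak0 mulmx0 mul0mx.
Qed.

(** Under the trace, Cayley-Hamilton keeps only its constant term: [n] times the determinant, up to
    sign, is zero. *)
Lemma unitmx_traceless n (A : 'M[F]_n) :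
  A \in unitmx -> (forall k, \tr (A ^+ k.+1) = 0) -> n = 0.
Proof.
case: n A => // n A; rewrite unitmxE unitfE => dA trA.
have /(congr1 mxtrace) := Cayley_Hamilton A.
rewrite -[char_poly A]coefK poly_def size_char_poly linear_sum /= linear_sum /=.
rewrite big_ord_recl big1 ?addr0 => [|i _]; last first.
  by rewrite linearZ /= rmorphXn /= horner_mx_X linearZ /= trA mulr0.
rewrite expr0 linearZ /= rmorph1 linearZ /= mxtrace1 linear0 char_poly_det.
by move/eqP; rewrite !mulf_eq0 signr_eq0 (negPf dA) pnatr_eq0.
Qed.

(* Induction on the size: an invertible traceless matrix is empty, and any other
   one has the same power traces as its smaller core. *)
Lemma mxtrace_exp_nilpotent n (A : 'M[F]_n) :
  (forall k, \tr (A ^+ k.+1) = 0) -> exists k, A ^+ k = 0.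
Proof.
elim/ltn_ind: n A => n IH A trA.
have [rA|rA] := ltnP (\rank A) n.
  have [k Ck0] := IH _ rA (mx_core A) (fun k => etrans (mxtrace_core_exp A k) (trA k)).
  by exists k.+1; rewrite mx_core_exp Ck0 mulmx0 mul0mx.
have uA : A \in unitmx by rewrite -row_free_unit /row_free eqn_leq rank_leq_row.
by exists 0; apply/matrixP => -[i lti]; have := lti; rewrite {1}(unitmx_traceless uA trA).
Qed.

End MatrixNilpotency.

(** * Trace and powers of an endomorphism, through its matrix *)

Section EndomorphismTrace.
Variables (F : numFieldType) (V : vectType F).
Implicit Types (f g : 'End(V)) (U : {vspace V}).

Lemma lfun_trace_is_scalar : scalar (@lfun_trace F V).
Proof. by move=> k f g; rewrite /lfun_trace linearP /= linearP. Qed.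

HB.instance Definition _ := GRing.isSemilinear.Build F 'End(V) F *%R (@lfun_trace F V)
  (GRing.semilinear_linear lfun_trace_is_scalar).

Lemma lfun_traceC f g : lfun_trace (f \o g)%VF = lfun_trace (g \o f)%VF.
Proof. by rewrite /lfun_trace !(mxof_comp _ _ (vbasisP _)) mxtrace_mulC. Qed.

Lemma lfun_trace_proj f U :
  (forall v, f v \in U) -> lfun_trace (f \o projv U)%VF = lfun_trace f.
Proof.
move=> fU; rewrite lfun_traceC; congr lfun_trace.
by apply/lfunP => v; rewrite comp_lfunE projv_id.
Qed.

Definition lfun_exp f n : 'End(V) := iter n (comp_lfun f) \1%VF.

Lemma lfun_expS f n : lfun_exp f n.+1 = (f \o lfun_exp f n)%VF.
Proof. by []. Qed.

Lemma lfun_expE f n v : lfun_exp f n v = iter n f v.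
Proof. by elim: n => [|n IH]; rewrite /= lfunE //= IH. Qed.

Lemma mxof_exp f n (b := vbasis {:V}) :
  mxof b b (lfun_exp f n) = mxof b b f ^+ n.
Proof.
have bb : basis_of {:V} b by exact: vbasisP.
elim: n => [|n IH]; first by rewrite mxof1 // (basis_free bb).
by rewrite /= (mxof_comp _ _ bb) IH exprSr.
Qed.

Lemma lfun_trace_nilpotent f n : lfun_exp f n = 0 -> lfun_trace f = 0.
Proof.
move=> fn0; apply: (@mxtrace_nilpotent _ _ _ n).
by rewrite -mxof_exp fn0 linear0.
Qed.

Lemma lfun_trace_exp_nilpotent f :
  (forall n, lfun_trace (lfun_exp f n.+1) = 0) -> exists n, lfun_exp f n = 0.
Proof.
move=> trf; case: (@mxtrace_exp_nilpotent _ _ (mxof (vbasis {:V}) (vbasis {:V}) f)).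
  by move=> n; rewrite -mxof_exp; apply: trf.
move=> n /eqP; rewrite -mxof_exp mxof_eq0 ?vbasisP // => /eqP fn0.
by exists n.
Qed.

End EndomorphismTrace.

(** * The product [jmul] on the derived algebra *)

Section Product.
Variables (F : numFieldType) (V : vectType F) (L : lieStructure V) (J : 'End(V)).
Hypotheses (hJ : complex_structure L J) (h2 : two_step_solvable L).

Local Notation A := (derived L).
Local Notation C := (derived_core L J).

Lemma bracket_derived x y : L x y \in A.
Proof. by rewrite mem_lie_prod ?memvf. Qed.

Lemma derived_abelian x y : x \in A -> y \in A -> L x y = 0.
Proof. by move=> xA yA; apply/eqP; rewrite -memv0 -h2 mem_lie_prod. Qed.

Lemma complex_structureK x : J (J x) = - x.
Proof. by have /lfunP/(_ x) := hJ.1; rewrite !lfun_simp. Qed.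

Lemma nijenhuis x y : L x y + J (L (J x) y) + J (L x (J y)) = L (J x) (J y).
Proof. by apply/eqP; rewrite -subr_eq0 hJ.2. Qed.

Lemma mem_derived_core x : (x \in C) = (x \in A) && (J x \in A).
Proof.
rewrite memv_cap; case: (x \in A) => //=; apply/memv_imgP/idP => [[y yA ->]|JxA].
  by rewrite complex_structureK memvN.
by exists (- J x); rewrite ?memvN // linearN /= complex_structureK opprK.
Qed.

Lemma derived_core_J x : x \in C -> J x \in C.
Proof.
by rewrite !mem_derived_core complex_structureK memvN => /andP[-> ->].
Qed.

Lemma derived_core_sub x : x \in C -> x \in A.
Proof. by rewrite mem_derived_core => /andP[]. Qed.

Lemma bracket_core_derived c x : c \in C -> x \in A -> L c x = 0.
Proof. by move=> /derived_core_sub cA; apply: derived_abelian. Qed.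

Definition jmul x y := L (J x) y.

Lemma jmul_derived x y : jmul x y \in A.
Proof. exact: bracket_derived. Qed.

Lemma bracketJJ x y : x \in A -> y \in A ->
  L (J x) (J y) = J (jmul x y - jmul y x).
Proof.
move=> xA yA; rewrite -nijenhuis derived_abelian // add0r -linearD.
by rewrite [L x _]bracketC.
Qed.

Lemma jmul_core c x : c \in C -> x \in A -> jmul c x = 0.
Proof. by move=> /derived_core_J; apply: bracket_core_derived. Qed.

(** By [bracketJJ], [J] sends the commutator to a bracket, hence into $\mathfrak g'$. *)
Lemma jmul_comm_core x y : x \in A -> y \in A -> jmul x y - jmul y x \in C.
Proof.
move=> xA yA; rewrite mem_derived_core -bracketJJ // bracket_derived andbT.
by rewrite rpredB ?jmul_derived.
Qed.

Lemma core_jmul x c : x \in A -> c \in C -> jmul x c \in C.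
Proof.
move=> xA cC; rewrite -[jmul x c]subr0 -(jmul_core cC xA).
exact: jmul_comm_core xA (derived_core_sub cC).
Qed.

(** Jacobi for [J x], [J y], [z], where $[z,[Jx,Jy]]$ vanishes because $\mathfrak g'$ is abelian. *)
Lemma jmulCA x y z : x \in A -> y \in A -> z \in A ->
  jmul x (jmul y z) = jmul y (jmul x z).
Proof.
move=> xA yA zA; have := bracket_jacobi L (J x) (J y) z.
rewrite [L z (J x)]bracketC [L z (L _ _)]bracketC linearN /=.
rewrite (derived_abelian (bracket_derived (J x) (J y)) zA) subr0.
by move/eqP; rewrite subr_eq0 => /eqP.
Qed.

(** The commutator lies in the core, which annihilates $\mathfrak g'$ from the left. *)
Lemma jmulCl x y z : x \in A -> y \in A -> z \in A ->
  jmul (jmul x y) z = jmul (jmul y x) z.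
Proof.
move=> xA yA zA; apply/eqP; rewrite -subr_eq0.
rewrite -(jmul_core (jmul_comm_core xA yA) zA) /jmul linearB /= bracketDl.
by rewrite -[- J _]scaleN1r bracketZl scaleN1r.
Qed.

(** * Right and left multiplications, extended to the whole space by first projecting onto
    $\mathfrak g'$, and their traces *)

Definition rmul x : 'End(V) := ((- ad L x) \o J \o projv A)%VF.
Definition lmul x : 'End(V) := (ad L (J x) \o projv A)%VF.

Lemma rmulE x v : rmul x v = jmul (projv A v) x.
Proof. by rewrite !comp_lfunE opp_lfunE adE [RHS]bracketC. Qed.

Lemma lmulE x v : lmul x v = jmul x (projv A v).
Proof. by rewrite lfunE /= adE. Qed.

Lemma rmul_id x v : v \in A -> rmul x v = jmul v x.
Proof. by move=> vA; rewrite rmulE projv_id. Qed.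

Lemma lmul_id x v : v \in A -> lmul x v = jmul x v.
Proof. by move=> vA; rewrite lmulE projv_id. Qed.

(** Operator form of [jmulCl]: behind a right multiplication, right multiplications turn into left
    ones. *)
Lemma rmul_rmul x y : x \in A -> y \in A ->
  (rmul x \o rmul y = rmul x \o lmul y)%VF.
Proof.
move=> xA yA; apply/lfunP => v; rewrite [LHS]comp_lfunE [RHS]comp_lfunE
  [rmul y v]rmulE lmulE.
by rewrite !rmul_id ?jmul_derived // jmulCl ?memv_proj.
Qed.

(** Operator form of [jmulCA]: $x(vy) = v(xy)$. *)
Lemma lmul_rmul x y : x \in A -> y \in A ->
  (lmul x \o rmul y = rmul (jmul x y))%VF.
Proof.
move=> xA yA; apply/lfunP => v; rewrite comp_lfunE !rmulE.
by rewrite lmul_id ?jmul_derived // jmulCA ?memv_proj.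
Qed.

(** The projection does not change the trace because [ad L x] has values in $\mathfrak g'$;
    cyclicity then brings [J] to the front. *)
Lemma lfun_trace_rmul x : lfun_trace (rmul x) = - lfun_trace (J \o ad L x)%VF.
Proof.
rewrite lfun_trace_proj => [|v]; last first.
  by rewrite comp_lfunE opp_lfunE memvN adE bracket_derived.
by rewrite comp_lfunNl linearN /= lfun_traceC.
Qed.

Lemma rmul_is_linear : linear rmul.
Proof.
move=> k x y; apply/lfunP => v; rewrite add_lfunE scale_lfunE !rmulE.
exact: linearP.
Qed.
HB.instance Definition _ := GRing.isSemilinear.Build F V 'End(V) _ rmul
  (GRing.semilinear_linear rmul_is_linear).

Lemma eta_rmul x y : eta L J x y = (2%:R)^-1 * lfun_trace (rmul (L x y)).
Proof. by rewrite /eta lfun_trace_rmul mulrN mulNr. Qed.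

Lemma eta0P : (forall x y, eta L J x y = 0) <->
  (forall z, z \in A -> lfun_trace (rmul z) = 0).
Proof.
split=> [eta0 z|tr0 x y]; last by rewrite eta_rmul tr0 ?mulr0 ?bracket_derived.
(* By definition $\mathfrak g'$ is a span of brackets, so linearity of the trace reduces [z] to a
   bracket. *)
move=> /(@coord_span _ _ _ (in_tuple _)) ->; rewrite !linear_sum big1 //= => i _.
rewrite !linearZ /=; set u := _`_i.
have /allpairsP[[x y] [_ _ ->]] :
    u \in [seq L a b | a <- vbasis fullv, b <- vbasis fullv].
  by rewrite mem_nth //= ltn_ord.
have /eqP := eta0 x y; rewrite eta_rmul mulf_eq0 invr_eq0 pnatr_eq0 /= => /eqP ->.
by rewrite mulr0.
Qed.

(** With $R$, $L$ the multiplications by [z], $R^{n+1} = R L^n$ has the trace of $L^n R$, which is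
    again a right multiplication by an element of $\mathfrak g'$. So all power traces vanish. *)
Lemma rmul_nilpotent z : (forall x, x \in A -> lfun_trace (rmul x) = 0) ->
  z \in A -> exists n, lfun_exp (rmul z) n = 0.
Proof.
move=> tr0 zA.
have rr n : (lfun_exp (rmul z) n.+1 = rmul z \o lfun_exp (lmul z) n)%VF.
  elim: n => [//|n IH].
  by rewrite lfun_expS IH [LHS]comp_lfunA rmul_rmul // -[LHS]comp_lfunA.
have lr n : exists2 x, x \in A & (lfun_exp (lmul z) n \o rmul z)%VF = rmul x.
  elim: n => [|n [x xA IH]]; first by exists z; rewrite // comp_lfun1l.
  by exists (jmul z x); rewrite ?jmul_derived // lfun_expS -[LHS]comp_lfunA IH lmul_rmul.
apply: lfun_trace_exp_nilpotent => n; rewrite rr lfun_traceC.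
by have [x xA ->] := lr n; apply: tr0.
Qed.

(** As $R_{zz} = L_z R_z$, a right multiplication in front of it turns it into $R_z^2$. *)
Lemma rmul_nilpotent_sqr z k : z \in A ->
  lfun_exp (rmul (jmul z z)) k = 0 -> exists n, lfun_exp (rmul z) n = 0.
Proof.
(* The odd factor is the leading [rmul z] that makes this replacement possible. *)
move=> zA zk0; exists k.*2.+1; rewrite lfun_expS.
have r3 x : x \in A -> (rmul x \o rmul (jmul z z) = rmul x \o rmul z \o rmul z)%VF.
  by move=> xA; rewrite -(lmul_rmul zA zA) [LHS]comp_lfunA -rmul_rmul.
have e n x : x \in A ->
    (rmul x \o lfun_exp (rmul (jmul z z)) n = rmul x \o lfun_exp (rmul z) n.*2)%VF.
  elim: n x => //= n IH x xA.
  by rewrite [LHS]comp_lfunA r3 // -[LHS]comp_lfunA IH // -[LHS]comp_lfunA.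
by rewrite -e // zk0 comp_lfun0r.
Qed.


(** * An Engel-type argument for multiplication modulo the core *)

Definition rmul_nil := forall z, z \in A -> exists n, lfun_exp (rmul z) n = 0.

Lemma rmul_jmul_core z v : z \in A -> v \in A -> rmul z v - jmul z v \in C.
Proof. by move=> zA vA; rewrite rmul_id ?jmul_comm_core. Qed.

(** Induction on [s]: a vector killed modulo [K] by the tail is replaced by its iterate under
    [rmul z] just before entering [K], which exists by nilpotency. *)
Lemma common_kernel_mod (K : {vspace V}) (s : seq V) a0 : rmul_nil ->
    (C <= K)%VS -> (forall x v, x \in A -> v \in K -> jmul x v \in K) ->
    {subset s <= A} -> a0 \in A -> a0 \notin K ->
  exists a, [/\ a \in A, a \notin K & forall x, x \in s -> jmul x a \in K].
Proof.
move=> nilA /subvP CK KS sA a0A a0K; elim: s sA => [|z s IH] sA; first by exists a0.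
have zA : z \in A by rewrite sA ?mem_head.
have {}sA : {subset s <= A} by move=> x xs; rewrite sA // in_cons xs orbT.
have [a [aA aK as_]] := IH sA; have [n zn0] := nilA z zA.
have {zn0} : iter n (rmul z) a \in K by rewrite -lfun_expE zn0 lfunE mem0v.
elim: n a aA aK as_ => [|n IHn] a aA aK as_ na; first by rewrite na in aK.
have CKz := CK _ (rmul_jmul_core zA aA).
have [zaK|zaK] := boolP (rmul z a \in K).
  exists a; split=> // x; rewrite in_cons => /predU1P[->|]; last exact: as_.
  by rewrite -[jmul z a](subKr (rmul z a)) rpredB.
apply: (IHn (rmul z a)) => //; first by rewrite rmulE jmul_derived.
  (* Up to the core [rmul z a] is $za$, and $x(za) = z(xa)$ lies in [K] because $xa$ does. *)
  move=> x xs; have xA := sA x xs.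
  rewrite -[rmul z a](subrK (jmul z a)) {1}/jmul bracketDr.
  rewrite rpredD //; first by apply/CK/core_jmul => //; apply: rmul_jmul_core.
  by rewrite -/(jmul x _) jmulCA // KS // as_.
by rewrite -iterSr.
Qed.

Definition jprod (K : {vspace V}) := lie_prod L (J @: A) K.

Lemma jprodP (K W : {vspace V}) :
  reflect (forall x v, x \in A -> v \in K -> jmul x v \in W) (jprod K <= W)%VS.
Proof.
apply: (iffP (lie_prod_subP _ _ _ _)) => KW x v.
  by move=> xA; apply: KW; apply: memv_img.
by move=> /memv_imgP[y yA ->]; apply: KW.
Qed.

Lemma mem_jprod (K : {vspace V}) x v : x \in A -> v \in K -> jmul x v \in jprod K.
Proof. exact/jprodP. Qed.

Lemma jprodS (K W : {vspace V}) : (K <= W)%VS -> (jprod K <= jprod W)%VS.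
Proof. by move=> /subvP KW; apply/jprodP => x v xA /KW; apply: mem_jprod. Qed.

Lemma iter_jprodS n (K W : {vspace V}) :
  (K <= W)%VS -> (iter n jprod K <= iter n jprod W)%VS.
Proof. by move=> KW; elim: n => //= n; apply: jprodS. Qed.

Lemma iter_jprod_derived n : (iter n jprod A <= A)%VS.
Proof. by case: n => //= n; apply/jprodP => x v _ _; apply: jmul_derived. Qed.

(* A stable [K] between [C] and [derived L] that is not everything is enlarged by
   one vector killed modulo [K] by all multiplications. *)
Lemma jprod_nilpotent : rmul_nil -> exists n, (iter n jprod A <= C)%VS.
Proof.
move=> nilA.
suff grow d (K : {vspace V}) : (\dim A - \dim K <= d)%N -> (C <= K)%VS ->
    (K <= A)%VS -> (jprod K <= K)%VS -> (exists n, iter n jprod K <= C)%VS ->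
    (exists n, iter n jprod A <= C)%VS.
  apply: (grow _ C (leqnn _)) => //; first exact: capvSl.
    by apply/jprodP; apply: core_jmul.
  by exists 0.
elim: d K => [|d IH] K dK CK KA /jprodP KS [n Kn].
  suff <- : K = A by exists n.
  by apply/eqP; rewrite eqEdim KA -subn_eq0 -leqn0.
have [AK|/subvPn[a0 a0A a0K]] := boolP (A <= K)%VS.
  by exists n; apply: subv_trans Kn; apply: iter_jprodS.
have sA : {subset vbasis A <= A} by move=> x; apply: vbasis_mem.
have [a [aA aK as_]] := common_kernel_mod nilA CK KS sA a0A a0K.
have aS x : x \in A -> jmul x a \in K.
  move=> xA; rewrite /jmul bracketC memvN (coord_vbasis xA) !linear_sum.
  apply: memv_suml => i _; rewrite !linearZ memvZ //= bracketC memvN.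
  by rewrite as_ // mem_nth ?size_tuple.
have K'K : (jprod (K + <[a]>) <= K)%VS.
  apply/jprodP => x _ xA /memv_addP[k kK [_ /vlineP[c ->] ->]].
  have -> : jmul x (k + c *: a) = jmul x k + c *: jmul x a.
    by rewrite /jmul linearD linearZ.
  by apply: rpredD; [apply: KS | apply/memvZ/aS].
apply: (IH (K + <[a]>)%VS).
- rewrite leq_subLR -ltnS -addnS; apply: leq_ltn_trans (_ : _ <= \dim K + d.+1)%N _.
    by rewrite -leq_subLR.
  rewrite ltn_add2r ltnNge; apply/negP => K'K_dim.
  have /eqP KE : K == (K + <[a]>)%VS by rewrite eqEdim addvSl.
  by rewrite KE (subvP (addvSr _ _)) ?memv_line in aK.
- exact: subv_trans CK (addvSl _ _).
- by rewrite subv_add KA.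
- exact: subv_trans K'K (addvSl _ _).
(* One multiplication takes the enlarged space into [K], hence the extra step. *)
exists n.+1; rewrite iterSr; apply: subv_trans Kn; exact: iter_jprodS.
Qed.


(** * The J-series and the lower central series of the quotient, bounded by powers of $\mathfrak
    g'$ *)

Definition jlayer n := (iter n jprod A + C)%VS.

Lemma jlayer_derived n x : x \in jlayer n -> x \in A.
Proof. by apply: subvP; rewrite subv_add iter_jprod_derived capvSl. Qed.

Lemma jmul_jlayer n x v : x \in A -> v \in jlayer n -> jmul x v \in jlayer n.+1.
Proof.
move=> xA /memv_addP[u uA [c cC ->]]; rewrite /jmul bracketDr.
by apply: memv_add; [apply: mem_jprod | apply: core_jmul].
Qed.

(** For $x+Jy$ and $u+Jv$ from one layer, $[x,u]=0$, the mixed brackets are products up to sign, and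
    $[Jy,Jv]$ is [J] of a difference of products; all land one layer further. *)
Lemma J_series_jlayer n :
  (J_series L J n.+1 <= jlayer n + J @: jlayer n)%VS.
Proof.
elim: n => [|n IH]; first by rewrite addvS ?limgS ?addvSl.
set X := J_series L J n.+1 in IH *; set T := (_ + _)%VS.
(* [T] is stable under [J] because $J^2=-1$, so it is enough to bound the brackets. *)
suff XT : (lie_prod L X X <= T)%VS.
  rewrite subv_add XT; apply/subvP => _ /memv_imgP[v /(subvP XT) + ->].
  case/memv_addP=> x xW [_ /memv_imgP[y yW ->] ->].
  rewrite linearD /= complex_structureK addrC memv_add ?memvN //.
  exact: memv_img.
apply/lie_prod_subP => a b.
move=> /(subvP IH)/memv_addP[x xW [_ /memv_imgP[y yW ->] ->]].
move=> /(subvP IH)/memv_addP[u uW [_ /memv_imgP[v vW ->] ->]].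
have [[[xA yA] uA] vA] := (jlayer_derived xW, jlayer_derived yW,
                       jlayer_derived uW, jlayer_derived vW).
rewrite bracketDl !bracketDr (derived_abelian xA uA) add0r bracketJJ //.
rewrite [L x _]bracketC addrA [X in X + _]addrC.
apply: memv_add; first by apply: rpredB; apply: jmul_jlayer.
by apply: memv_img; rewrite rpredB ?jmul_jlayer.
Qed.

Lemma J_solvable_rmul_nil : rmul_nil -> J_solvable L J.
Proof.
move=> /jprod_nilpotent[n nC]; have WC : (jlayer n <= C)%VS by rewrite subv_add nC subvv.
have XC : (J_series L J n.+1 <= C)%VS.
  apply: subv_trans (J_series_jlayer n) _; rewrite subv_add WC.
  apply/subvP => _ /memv_imgP[x /(subvP WC) xC ->].
  exact: derived_core_J.
(* The term of index [n.+1] lies in the core, which is abelian, so the next one is zero. *)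
exists n.+2; rewrite /= -/(J_series L J n.+1).
suff -> : lie_prod L (J_series L J n.+1) (J_series L J n.+1) = 0%VS.
  by rewrite limg0 addv0.
apply/eqP; rewrite -subv0; apply/lie_prod_subP => a b /(subvP XC) aC /(subvP XC) bC.
by rewrite (bracket_core_derived aC (derived_core_sub bC)) mem0v.
Qed.

Lemma J_series_J n x : x \in J_series L J n -> J x \in J_series L J n.
Proof.
case: n => [|n] /=; first by move=> _; rewrite memvf.
case/memv_addP=> u uX [_ /memv_imgP[v vX ->] ->].
rewrite linearD /= complex_structureK addrC memv_add ?memvN //.
exact: memv_img.
Qed.

(** If $z\in\mathfrak g'$ lies in a term of the series, $zz = [Jz,z]$ lies in the next. Right
    multiplication by 0 is zero, and [rmul_nilpotent_sqr] carries nilpotency back up. *)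
Lemma rmul_nil_J_solvable : J_solvable L J -> rmul_nil.
Proof.
case=> n n0 z zA; have : z \in J_series L J 0 by rewrite memvf.
move: n0; rewrite -[n]addn0; elim: n 0%N z zA => [|n IH] m z zA m0 zm.
  move: zm; rewrite add0n in m0; rewrite m0 memv0 => /eqP ->; exists 1%N.
  by rewrite lfun_expS comp_lfun1r linear0.
rewrite addSnnS in m0; have [|k] := IH m.+1 (jmul z z) (jmul_derived _ _) m0.
  by rewrite /= (subvP (addvSl _ _)) // mem_lie_prod // J_series_J.
exact: rmul_nilpotent_sqr.
Qed.

(** For $x,y,u\in\mathfrak g'$, $[x+Jy,u] = yu$, so each further bracket in the quotient advances
    one layer. The first one only reaches $\mathfrak g'$, whence the shift of index. *)
Lemma derived_quotient_nilpotent : rmul_nil -> nilpotent (derived_quotient hJ h2).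
Proof.
case/jprod_nilpotent=> n nC.
have WC : (jlayer n <= C)%VS by rewrite subv_add nC subvv.
pose D := derived_plus L J; pose I := restrv D C.
suff lcW m : (lower_central (derived_quotient hJ h2) m.+1
    <= linfun (piv I) @: restrv D (jlayer m))%VS.
  exists n.+1; apply/eqP; rewrite -subv0; apply: subv_trans (lcW n) _.
  apply/subvP => _ /memv_imgP[u + ->]; rewrite mem_restrv lfunE memv0 /= piv_eq0.
  by rewrite mem_restrv; apply: (subvP WC).
have step a u (W : {vspace V}) (u' := piv I u) :
    vsval (sub_lie (@derived_plus_subalgebra _ _ L J) (reprv a) u) \in W ->
    derived_quotient hJ h2 a u' \in (linfun (piv I) @: restrv D W)%VS.
  move=> auW; rewrite -[a in derived_quotient _ _ a _]reprvK.
  rewrite -[derived_quotient _ _ _ _](piv_bracket (derived_core_ideal hJ h2)).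
  rewrite -[piv _ _]lfunE.
  by apply: memv_img; rewrite mem_restrv.
elim: m => [|m IH]; apply/lie_prod_subP => a b _.
  move=> _; rewrite -[b]reprvK; apply: step => /=.
  by rewrite (subvP (addvSl _ _)) ?bracket_derived.
move=> /(subvP IH)/memv_imgP[u + ->]; rewrite mem_restrv lfunE => uW.
apply: step => /=; case/memv_addP: (subvsP (reprv a)) => x xA [_ /memv_imgP[y yA ->] ->].
rewrite bracketDl derived_abelian ?add0r; first exact: jmul_jlayer.
  by [].
exact: jlayer_derived uW.
Qed.

Lemma eta0_rmul_nil : (forall x y, eta L J x y = 0) <-> rmul_nil.
Proof.
rewrite eta0P; split=> [tr0 z|nilA z /nilA[n]]; first exact: rmul_nilpotent.
exact: lfun_trace_nilpotent.
Qed.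

End Product.

Theorem proposition5p2 (R : realType) (V : vectType R) (L : lieStructure V)
    (J : 'End(V)) (hJ : complex_structure L J) (h2 : two_step_solvable L) :
  ((forall x y : V, eta L J x y = 0) <-> J_solvable L J) /\
  ((forall x y : V, eta L J x y = 0) -> nilpotent (derived_quotient hJ h2)).
Proof.
rewrite (eta0_rmul_nil hJ h2); split.
  by split; [apply: J_solvable_rmul_nil | apply: rmul_nil_J_solvable].
exact: derived_quotient_nilpotent.
Qed.
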